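(* For every even integer $d \ge 6$, we have $e^*(d) \ge \frac{2d-3}{3}$. For every odd integer $d \ge 7$, we have $e^*(d) \ge \frac{2d-5}{3}$.
   Context: For a polynomial $P(x)$ with integer coefficients, its (naive) height $H(P)$ is the maximum of the absolute values of its coefficients. For a separable integer polynomial $P(x)$ of degree $d \ge 2$ with distinct complex roots $\alpha_1,\dots,\alpha_d$, set $\mathrm{sep}(P) = \min_{1\le i<j\le d} |\alpha_i - \alpha_j|$, and define the real number $e(P)$ by $\mathrm{sep}(P) = H(P)^{-e(P)}$. For $d \ge 2$, let $e^*(d) = \limsup e(P)$, where the limsup is taken over all separable monic integer polynomials $P(x)$ of degree $d$ as $H(P) \to +\infty$. *)

(* Defs.v *)
From HB Require Import structures.
From mathcomp Require Import all_boot all_order all_algebra.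
From mathcomp Require Import separable.
From mathcomp Require Import complex.
From mathcomp Require Import boolp classical_sets reals ereal exp.

Set Implicit Arguments.
Unset Strict Implicit.
Unset Printing Implicit Defensive.

Import Order.TTheory GRing.Theory Num.Theory.

Local Open Scope classical_set_scope.
Local Open Scope ring_scope.

Definition height (P : {poly int}) : nat := \max_(i < size P) absz (P`_i)%R.

Section RootSeparation.
Variable R : realType.
Implicit Types (P : {poly int}) (d : nat).

Definition cpoly P : {poly R[i]} := map_poly intr P.

Definition root_dists P : set R :=
  [set r | exists a b : R[i],
     [/\ root (cpoly P) a, root (cpoly P) b, a != b & r = Normc.normc (a - b)]].

(* For P separable of degree at least 2 this infimum is a minimum: see
   sep_min. *)
Definition sep P : R := inf (root_dists P).

(* The solution e of sep P = H(P)^(-e) when H(P) >= 2: see sepexpP. The value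
   is meaningless for H(P) = 1. *)
Definition sepexp P : R := - ln (sep P) / ln (height P)%:R.

Definition sep_monic d : set {poly int} :=
  [set P | [/\ P \is monic, size P = d.+1 & separable_poly (cpoly P)]].

(* limsup of sepexp over sep_monic d as H(P) -> +oo, in the form
   inf_N sup_(H(P) >= N). *)
Definition estar d : \bar R :=
  ereal_inf [set ereal_sup [set (sepexp P)%:E |
                              P in sep_monic d `&` [set P | (N <= height P)%N]]
            | N in [set: nat]].

Lemma size_cpoly P : size (cpoly P) = size P.
Proof. by apply: size_map_inj_poly => //; exact: intr_inj. Qed.

Lemma cpoly_roots P : P != 0 -> separable_poly (cpoly P) ->
  exists s : seq R[i],
    [/\ uniq s, size s = (size P).-1 & forall z, root (cpoly P) z = (z \in s)].
Proof.
move=> P0 sP; have [s Es] := closed_field_poly_normal (cpoly P).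
have l0 : lead_coef (cpoly P) != 0.
  by rewrite lead_coef_eq0 -size_poly_eq0 size_cpoly size_poly_eq0.
exists s; split.
- move: sP; rewrite Es (eqp_separable (eqp_scale _ l0)).
  by rewrite separable_prod_XsubC.
- by rewrite -size_cpoly Es size_scale // size_prod_XsubC.
- by move=> z; rewrite Es rootZ // root_prod_XsubC.
Qed.

Lemma sep_min P : (2 < size P)%N -> separable_poly (cpoly P) ->
  root_dists P (sep P) /\ lbound (root_dists P) (sep P).
Proof.
move=> sz sP; have P0 : P != 0 by rewrite -size_poly_eq0; case: size sz.
have [s [us ss rs]] := cpoly_roots P0 sP.
have lb0 : lbound (root_dists P) 0.
  by move=> _ [a [b [_ _ _ ->]]]; case: (a - b) => x y; exact: sqrtr_ge0.
have lbs : lbound (root_dists P) (sep P).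
  by move=> r Dr; apply: ge_inf => //; exists 0.
split=> //.
pose t := [seq ab <- [seq (a, b) | a <- s, b <- s] | ab.1 != ab.2].
pose f (ab : R[i] * R[i]) := Normc.normc (ab.1 - ab.2).
have Dt r : root_dists P r <-> exists2 ab, ab \in t & r = f ab.
  split=> [[a [b [ra rb ab ->]]]|[[a b]]].
    exists (a, b) => //; rewrite mem_filter ab /=.
    by apply/allpairsP; exists (a, b); rewrite -!rs.
  rewrite mem_filter /= => /andP[ab /allpairsP[[a' b'] [/= ha hb [ea eb]]]] ->.
  by exists a, b; split; rewrite // rs ?ea ?eb.
have [x [y xyt]] : exists x y, (x, y) \in t.
  have : (1 < size s)%N by rewrite ss; case: size sz => [|[|[]]].
  rewrite /t; case: (s) us => [|x [|y s']] // /andP[xy _] _; exists x, y.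
  rewrite mem_filter; apply/andP; split.
    by apply: contraNneq xy => /= ->; rewrite mem_head.
  by apply/allpairsP; exists (x, y); rewrite /= !inE !eqxx ?orbT.
have [ab abt abm] : exists2 ab, ab \in t & forall cd, cd \in t -> f ab <= f cd.
  elim: (t) (x, y) xyt => // u l IH v _.
  case: l IH => [|w l] IH; first by exists u; rewrite ?mem_head// => c /[!inE] /eqP->.
  have [ab abl abm] := IH w (mem_head _ _).
  have [h|h] := leP (f u) (f ab).
    exists u; rewrite ?mem_head // => c; rewrite inE => /orP[/eqP->//|/abm].
    exact: le_trans.
  exists ab; first by rewrite inE abl orbT.
  by move=> c; rewrite inE => /orP[/eqP->|/abm//]; exact: ltW.
apply/Dt; exists ab => //; apply/eqP; rewrite eq_le; apply/andP; split.
  by apply: lbs; apply/Dt; exists ab.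
apply: lb_le_inf; first by exists (f ab); apply/Dt; exists ab.
by move=> r /Dt[cd cdt ->]; exact: abm.
Qed.

Lemma sepexpP P (e : R) :
  (2 < size P)%N -> separable_poly (cpoly P) -> (1 < height P)%N ->
  sep P = (height P)%:R `^ (- e) <-> e = sepexp P.
Proof.
move=> sz sP H1.
have s0 : 0 < sep P.
  have [[a [b [_ _ ab ->]]] _] := sep_min sz sP.
  have : 0 < `|a - b| by rewrite normr_gt0 subr_eq0.
  by rewrite -ltcR; case: (a - b).
have H0 : 0 < (height P)%:R :> R by rewrite ltr0n; case: height H1.
have l0 : ln (height P)%:R != 0 :> R by rewrite gt_eqF // ln_gt0 // ltr1n.
split=> [E|->]; first by rewrite /sepexp E ln_powR -mulNr opprK mulfK.
by rewrite /powR gt_eqF // /sepexp -mulNr opprK divfK // lnK.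
Qed.

End RootSeparation.

(* Main.v *)
Require Import Defs.
From mathcomp Require Import all_boot all_order all_algebra.
From mathcomp Require Import reals ereal.
From mathcomp Require Import separable complex boolp sequences exp.
From mathcomp Require Import ring lra zify.

(** Let [q] be the quadratic [X^2 - (t^2 + t + 1) X + t], with roots [a ~ 1/t] and
    [a' ~ t^2], and let [s = X^2 + (t + 1) X - 1].  Then [s(a) s(a') = -1], so
    [s(a) = O(t^-4)].  Modulo [q] the power [s^m] is congruent to a monic
    polynomial [A_m + t B_m] of degree [2m], where [A_m] and [B_m] do not depend on
    [t].  It takes at [a] the value [s(a)^m = O(t^(-4m))], while its derivative
    there has order [t]; hence it has a root at distance [O(t^(-4m-1))] from [a].
    The product [q (A_m + t B_m)] has degree [d = 2m + 2] and height [O(t^3)],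
    which gives the exponent [(4m + 1) / 3 = (2d - 3) / 3].  In odd degree one
    multiplies by [X]. *)

Set Implicit Arguments.
Unset Strict Implicit.
Unset Printing Implicit Defensive.

Import Order.TTheory GRing.Theory Num.Theory.

Local Open Scope ring_scope.

(** * Roots near a given point, and separability in a linear pencil *)

Section RootProximity.
Variable F : numClosedFieldType.
Implicit Types (p a b : {poly F}) (x z e t : F).

(** The logarithmic derivative [p'/p] at [x] is the sum of the [1 / (x - z)], each of modulus at
    most [1 / e]. Denominators are cleared so that induction with the product rule applies. *)
Lemma dist_mul_deriv_le (s : seq F) x e : 0 <= e ->
    (forall z, z \in s -> e <= `|x - z|) ->
  let p := \prod_(z <- s) ('X - z%:P) in
  e * `|p^`().[x]| <= (size s)%:R * `|p.[x]|.
Proof.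
move=> e0 /=; elim: s => [|z s IH] h.
  by rewrite big_nil derivC horner0 normr0 mulr0 mul0r.
rewrite big_cons derivM derivXsubC mul1r hornerD !hornerM hornerXsubC.
set p := \prod_(_ <- s) _ in IH *.
have hz : e <= `|x - z| by apply: h; rewrite mem_head.
have {}IH : e * `|p^`().[x]| <= (size s)%:R * `|p.[x]|.
  by apply: IH => y ys; apply: h; rewrite inE ys orbT.
apply: le_trans (ler_wpM2l e0 (ler_normD _ _)) _.
rewrite mulrDr !normrM /= -natr1 mulrDl mul1r addrC lerD ?ler_wpM2r//.
by rewrite mulrCA [leRHS]mulrCA ler_wpM2l.
Qed.

Lemma exists_near_root p x e : p \is monic -> 0 <= e ->
    (size p).-1%:R * `|p.[x]| < e * `|p^`().[x]| ->
  exists2 z, root p z & `|x - z| < e.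
Proof.
move=> /monicP pm e0 h; have [s Es] := closed_field_poly_normal p.
rewrite pm scale1r in Es.
have rs z : root p z = (z \in s) by rewrite Es root_prod_XsubC.
have ss : (size p).-1 = size s by rewrite Es size_prod_XsubC.
have [/hasP[z zs hz]|/hasPn hs] := boolP (has (fun z => `|x - z| < e) s).
  by exists z => //; rewrite rs.
have : e * `|p^`().[x]| <= (size p).-1%:R * `|p.[x]|.
  rewrite ss Es; apply: dist_mul_deriv_le => // z /hs.
  by rewrite -real_leNgt ?normr_real ?ger0_real.
by move=> /(lt_le_trans h); rewrite ltxx.
Qed.

(* A double root of a + t b is a zero of the Wronskian, and it determines t. *)
Lemma separable_pencil a b : a * b^`() - a^`() * b != 0 ->
    (forall z, root a z -> ~~ root b z) ->
  exists2 M : F, M \is Num.real &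
    forall t, M < `|t| -> separable_poly (a + t *: b).
Proof.
set w := _ - _ => w0 ab; have [s Es] := closed_field_poly_normal w.
have rs z : root w z -> z \in s.
  by rewrite Es rootZ ?lead_coef_eq0// root_prod_XsubC.
(* A double root [z] forces [t = - a(z) / b(z)], so the sum over all zeros of the Wronskian exceeds
   every bad [|t|]. Zeros with [b(z) = 0] contribute [0], by the convention on division. *)
exists (\sum_(z <- s) `|a.[z] / b.[z]|).
  by apply: ger0_real; apply: sumr_ge0 => *; apply: normr_ge0.
move=> t; apply: contraTT; rewrite separable_poly.unlock.
move=> /(elimN (Pdiv.ClosedField.coprimepP _ _)) h.
have [z rz rz'] : exists2 z, root (a + t *: b) z & root (a + t *: b)^`() z.
  apply: contrapT => hz; apply: h => z rz; apply/negP => rz'.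
  by apply: hz; exists z.
move: rz rz'; rewrite /root derivD derivZ !hornerD !hornerZ => /eqP rz /eqP rz'.
have bz : b.[z] != 0.
  apply/negP => bz; have /ab/negP : root a z; last exact.
  by move: rz; rewrite (eqP bz) mulr0 addr0 /root => ->.
have tE : t = - (a.[z] / b.[z]).
  by apply: (mulIf bz); rewrite mulNr divfK//; apply/eqP; rewrite -addr_eq0 addrC rz.
have /rs zs : root w z.
  rewrite /root /w hornerD hornerN !hornerM; apply/eqP.
  have -> : a.[z] = - (t * b.[z]) by apply/eqP; rewrite -addr_eq0 rz.
  have -> : a^`().[z] = - (t * b^`().[z]) by apply/eqP; rewrite -addr_eq0 rz'.
  by ring.
rewrite -real_leNgt ?normr_real//; last first.
  by apply: ger0_real; apply: sumr_ge0 => *; apply: normr_ge0.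
rewrite (big_rem z)//= tE normrN lerDl.
by apply: sumr_ge0 => *; apply: normr_ge0.
Qed.

End RootProximity.

(** * Elementary height inequalities *)

Lemma coef_le_height (p : {poly int}) i : (absz (p`_i)%R <= height p)%N.
Proof.
have [ip|ip] := ltnP i (size p); last by rewrite nth_default.
exact: (@leq_bigmax _ (fun i : 'I_(size p) => absz p`_i) (Ordinal ip)).
Qed.

Lemma height_le (p : {poly int}) n :
  (forall i, (absz (p`_i)%R <= n)%N) -> (height p <= n)%N.
Proof. by move=> h; apply/bigmax_leqP => i _; exact: h. Qed.

Lemma heightD (p q : {poly int}) : (height (p + q)%R <= height p + height q)%N.
Proof.
apply: height_le => i; rewrite coefD.
by have := coef_le_height p i; have := coef_le_height q i; lia.
Qed.

Lemma heightZ (c : int) (p : {poly int}) : (height (c *: p)%R <= absz c * height p)%N.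
Proof.
by apply: height_le => i; rewrite coefZ abszM leq_mul2l coef_le_height orbT.
Qed.

(** * The pair [(A_m, B_m)] and reduction modulo the quadratic *)

Fixpoint pencil m : {poly int} * {poly int} :=
  if m is k.+1 then
    (('X^2 + 'X - 1) * (pencil k).1 + ('X^2 - 'X) * (pencil k).2,
     'X * (pencil k).1 + 'X^2 * (pencil k).2)
  else (1, 0).

Definition quadratic (t : int) : {poly int} :=
  'X^2 - (t ^+ 2 + t + 1) *: 'X + t%:P.

Definition companion (t : int) m : {poly int} :=
  (pencil m).1 + t *: (pencil m).2.

(* Modulo the quadratic, companion t m is the m-th power of companion t 1; the
   recursion of pencil eliminates t ^+ 2 through
   t ^+ 2 * x = x ^+ 2 - (t + 1) * x + t. *)
Lemma companionS t m :
  companion t m.+1 =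
  companion t m * ('X^2 + (t + 1) *: 'X - 1) + quadratic t * (pencil m).2.
Proof.
by rewrite /companion /quadratic /= -!mul_polyC !rmorphD /= rmorphXn /=; ring.
Qed.

(** Since [B_m] has degree below that of the monic [A_m], adding [t B_m] leaves the leading term
    alone, whatever [t] is. *)
Lemma pencil_size m :
  [/\ (pencil m).1 \is monic, size (pencil m).1 = (2 * m)%N.+1
    & (size (pencil m).2 <= 2 * m)%N].
Proof.
elim: m => [|m [Am sA sB]] /=; first by rewrite monic1 size_polyC size_poly0.
have lt_X : (size ('X - 1 : {poly int})%R < size ('X^2 : {poly int})%R)%N.
  by rewrite size_XsubC size_polyXn.
have sT : size ('X^2 + 'X - 1 : {poly int}) = 3%N.
  by rewrite -addrA size_polyDl// size_polyXn.
have Tm : ('X^2 + 'X - 1 : {poly int}) \is monic.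
  by rewrite -addrA monicE lead_coefDl// lead_coefXn.
have sTA : size (('X^2 + 'X - 1) * (pencil m).1) = (2 * m.+1)%N.+1.
  by rewrite size_monicM ?monic_neq0// sT sA; lia.
have sE : (size ('X^2 - 'X : {poly int})%R <= 3)%N.
  apply: leq_trans (size_polyD _ _) _.
  by rewrite size_polyN size_polyXn size_polyX.
have sEB : (size (('X^2 - 'X) * (pencil m).2)%R < (2 * m.+1)%N.+1)%N.
  apply: leq_ltn_trans (size_polyMleq _ _) _.
  by move: (leq_add sE sB); case: (addn (size _) _) => [|k] /=; lia.
rewrite monicE lead_coefDl ?sTA// size_polyDl ?sTA//.
split=> //; first by rewrite -monicE monicMl.
apply: leq_trans (size_polyD _ _) _; rewrite geq_max.
apply/andP; split; apply: leq_trans (size_polyMleq _ _) _.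
  by rewrite size_polyX sA; lia.
by rewrite size_polyXn; move: sB; move: (size _) => k; lia.
Qed.

Lemma companion_monic t m : companion t m \is monic.
Proof.
have [Am sA sB] := pencil_size m.
by rewrite monicE lead_coefDl// sA ltnS (leq_trans (size_scale_leq _ _)).
Qed.

Lemma size_companion t m : size (companion t m) = (2 * m)%N.+1.
Proof.
have [Am sA sB] := pencil_size m.
by rewrite size_polyDl// sA ltnS (leq_trans (size_scale_leq _ _)).
Qed.

Lemma quadraticE t : quadratic t = 'X^2 + (t%:P - (t ^+ 2 + t + 1) *: 'X).
Proof. by rewrite /quadratic addrAC addrA. Qed.

Lemma size_quadratic_tail t :
  (size (t%:P - (t ^+ 2 + t + 1) *: 'X : {poly int})%R < size ('X^2 : {poly int})%R)%N.
Proof.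
rewrite size_polyXn ltnS (leq_trans (size_polyD _ _))// geq_max size_polyN.
rewrite (leq_trans (size_polyC_leq1 _))//.
by rewrite (leq_trans (size_scale_leq _ _)) ?size_polyX.
Qed.

Lemma quadratic_monic t : quadratic t \is monic.
Proof.
by rewrite quadraticE monicE lead_coefDl ?size_quadratic_tail// lead_coefXn.
Qed.

Lemma size_quadratic t : size (quadratic t) = 3%N.
Proof. by rewrite quadraticE size_polyDl ?size_quadratic_tail// size_polyXn. Qed.

(** It follows that [companion t m] takes the value [(-1)^m] at [0]; this keeps it coprime to [X]
    and gives a lower bound for the height. *)
Lemma pencil_coef0 m : (pencil m).1`_0 = (-1) ^+ m /\ (pencil m).2`_0 = 0.
Proof.
elim: m => [|m [A0 B0]] /=; first by rewrite !coefE.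
by rewrite !coefD !coef0M !coefB !coefD A0 B0 !coefE /= exprS; split; ring.
Qed.

(** This is the derivative of [B_(m+1)] at [0]. Being nonzero, it gives [companion] a derivative of
    order [t] near [0], and a nonzero Wronskian. *)
Lemma pencil_coef1 m : (pencil m.+1).2`_1 = (-1) ^+ m.
Proof.
by rewrite /= coefD mulrC coefMX [_ * _.2]mulrC coefMXn /= (pencil_coef0 m).1 addr0.
Qed.

(** * Values at the roots of the quadratic *)

Section Eval.
Variable K : idomainType.
Implicit Types z : K.
Local Notation ev p z := (map_poly intr p : {poly K}).[z].

Lemma ev_pencil1 m z : ev (pencil m.+1).1 z =
  (z ^+ 2 + z - 1) * ev (pencil m).1 z + (z ^+ 2 - z) * ev (pencil m).2 z.
Proof.
rewrite /= !(rmorphD, rmorphM, rmorphN, rmorph1, map_polyXn, map_polyX) /=.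
by rewrite !map_polyX !hornerE.
Qed.

Lemma ev_pencil2 m z : ev (pencil m.+1).2 z =
  z * ev (pencil m).1 z + z ^+ 2 * ev (pencil m).2 z.
Proof.
rewrite /= !(rmorphD, rmorphM, rmorphN, rmorph1, map_polyXn, map_polyX) /=.
by rewrite !map_polyX !hornerE.
Qed.

Lemma ev0 p : ev p 0 = (p`_0)%:~R.
Proof. by rewrite horner_coef0 coef_map. Qed.

(* The matrix of the recursion has determinant x ^+ 4. *)
Lemma pencil_no_common_root m z :
  root (map_poly intr (pencil m).1) z -> ~~ root (map_poly intr (pencil m).2) z.
Proof.
rewrite /root; have [->|z0] := eqVneq z 0.
  (* At [0] the determinant vanishes, but there [A_m] is [1] or [-1]. *)
  by rewrite ev0 (pencil_coef0 m).1 rmorphXn rmorphN1 signr_eq0.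
elim: m => [|m IH]; first by rewrite rmorph1 hornerC oner_eq0.
move=> /eqP A1; apply/negP => /eqP B1; move: A1 B1; rewrite ev_pencil1 ev_pencil2.
move: IH; set A := ev _ z; set B := ev _ z => IH A1 B1.
have z4 : z ^+ 4 != 0 by rewrite expf_neq0.
have A0 : A = 0.
  apply: (mulfI z4); rewrite mulr0.
  by rewrite -[RHS](subr0 0) -{1}(mulr0 (z ^+ 2)) -{1}A1 -(mulr0 (z ^+ 2 - z)) -B1; ring.
have B0 : B = 0.
  apply: (mulfI z4); rewrite mulr0.
  by rewrite -[RHS](subr0 0) -{1}(mulr0 (z ^+ 2 + z - 1)) -{1}B1 -(mulr0 z) -A1; ring.
by move: IH; rewrite A0 B0 eqxx => /(_ isT).
Qed.

Lemma ev_quadratic t z :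
  ev (quadratic t) z = z ^+ 2 - (t%:~R ^+ 2 + t%:~R + 1) * z + t%:~R.
Proof.
rewrite /quadratic -!mul_polyC !(rmorphD, rmorphM, rmorphN, map_polyXn, map_polyX, map_polyC) /=.
by rewrite !map_polyX !map_polyC !hornerE.
Qed.

Lemma ev_companion t m z :
  ev (companion t m) z = ev (pencil m).1 z + t%:~R * ev (pencil m).2 z.
Proof. by rewrite /companion rmorphD /= -mul_polyC rmorphM /= map_polyC !hornerE. Qed.

Lemma ev_companion_root t m z : ev (quadratic t) z = 0 ->
  ev (companion t m) z = (z ^+ 2 + (t%:~R + 1) * z - 1) ^+ m.
Proof.
move=> qz; elim: m => [|m IH].
  by rewrite ev_companion rmorph1 rmorph0 horner0 mulr0 addr0 hornerC.
rewrite companionS rmorphD !rmorphM /= hornerD !hornerM qz mul0r addr0 IH [RHS]exprSr.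
congr (_ * _); rewrite -mul_polyC !(rmorphD, rmorphM, rmorphN, map_polyXn, map_polyX, map_polyC) /=.
by rewrite !map_polyX !map_polyC rmorph1 !hornerE.
Qed.

(** This is the norm of [s] modulo the quadratic: [s] is small at one root exactly because it is
    large at the other. *)
Lemma ev_companion_conj t z z' :
    z + z' = t%:~R ^+ 2 + t%:~R + 1 -> z * z' = t%:~R ->
  (z ^+ 2 + (t%:~R + 1) * z - 1) * (z' ^+ 2 + (t%:~R + 1) * z' - 1) = -1.
Proof.
move: (t%:~R : K) => u hs hp.
(* Subtracting the quadratic makes [s] linear; the product then depends only on the sum and product
   of the roots. *)
have E y : y ^+ 2 - (u ^+ 2 + u + 1) * y + u = 0 ->
    y ^+ 2 + (u + 1) * y - 1 = (u ^+ 2 + 2 * u + 2) * y - (u + 1).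
  by move=> h; apply/eqP; rewrite -subr_eq0 -h; apply/eqP; ring.
rewrite !E; last 2 first.
- by rewrite -hs -hp; ring.
- by rewrite -hs -hp; ring.
have -> : forall c e : K, (c * z - e) * (c * z' - e) =
    c ^+ 2 * (z * z') - c * e * (z + z') + e ^+ 2 by move=> *; ring.
by rewrite hs hp; ring.
Qed.

End Eval.

(** * The family: degree and height *)

Definition family b t m : {poly int} := 'X^b * (quadratic t * companion t m).

Lemma family_monic b t m : family b t m \is monic.
Proof. by rewrite /family monicMl ?monicXn// monicMl ?quadratic_monic ?companion_monic. Qed.

Lemma size_family b t m : size (family b t m) = (2 * m + 2 + b)%N.+1.
Proof.
have nz := monic_neq0 (companion_monic t m).
rewrite /family mulrC size_mulXn; last by rewrite mulf_neq0// monic_neq0 ?quadratic_monic.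
by rewrite size_monicM ?quadratic_monic// size_quadratic size_companion; lia.
Qed.

(** The coefficient of [X^b] is [t] up to sign. Heights therefore become arbitrarily large along the
    family. *)
Lemma height_family_ge b (t : nat) m : (t <= height (family b t m))%N.
Proof.
apply: leq_trans (coef_le_height _ b).
rewrite /family mulrC coefMXn ltnn subnn coef0M.
have -> : (companion t m)`_0 = (-1) ^+ m.
  by rewrite coefD coefZ (pencil_coef0 m).1 (pencil_coef0 m).2 mulr0 addr0.
have -> : (quadratic t)`_0 = t by rewrite !coefE /= mulr0 subr0 add0r.
by rewrite abszM abszX exp1n muln1.
Qed.

Lemma height_family_le b m : exists D : nat, forall t : nat, (1 <= t)%N ->
  (height (family b t m) <= D * t ^ 3)%N.
Proof.
pose A := 'X^b * (pencil m).1; pose B := 'X^b * (pencil m).2.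
(* The family is a polynomial of degree 3 in [t] with coefficients free of [t]; the constant is the
   sum of their heights. *)
pose h := (height (('X^2 - 'X) * A)%R + height ((1 - 'X) * A + ('X^2 - 'X) * B)%R
  + height ((1 - 'X) * B - 'X * A)%R + height (- 'X * B : {poly int})%R)%N.
exists h => t t1; have -> : family b t m = ('X^2 - 'X) * A
    + (t : int) *: ((1 - 'X) * A + ('X^2 - 'X) * B)
    + (t : int) ^+ 2 *: ((1 - 'X) * B - 'X * A) + (t : int) ^+ 3 *: (- 'X * B).
  rewrite /family /A /B /quadratic /companion -!mul_polyC !rmorphD /= !rmorphXn /=.
  by ring.
apply: leq_trans (heightD _ _) _; rewrite mulnDl leq_add//; last first.
  by apply: leq_trans (heightZ _ _) _; rewrite mulnC leq_mul2l abszX leqnn orbT.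
apply: leq_trans (heightD _ _) _; rewrite mulnDl leq_add//; last first.
  apply: leq_trans (heightZ _ _) _; rewrite mulnC leq_mul2l abszX.
  by rewrite leq_pexp2l ?orbT.
apply: leq_trans (heightD _ _) _; rewrite mulnDl leq_add//; last first.
  apply: leq_trans (heightZ _ _) _; rewrite mulnC leq_mul2l /=.
  by rewrite -{1}(expn1 t) leq_pexp2l ?orbT.
by rewrite -{1}(muln1 (height _)) leq_mul2l expn_gt0 t1 orbT.
Qed.

(** * Real roots of the quadratic and separability for large [t] *)

Section Asymptotics.
Variable R : realType.
Local Notation rpoly p := (map_poly intr p : {poly R}).
Local Notation C := (R[i]).

Lemma cpoly_real (p : {poly int}) (x : R) :
  (cpoly R p).[x%:C%C] = ((rpoly p).[x])%:C%C.
Proof.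
rewrite -horner_map /= -map_poly_comp; congr (_.[_]).
by apply: eq_map_poly => k /=; rewrite rmorph_int.
Qed.

Lemma quadratic_roots (t : nat) : (1 <= t)%N -> exists a a' : R,
  [/\ a + a' = t%:R ^+ 2 + t%:R + 1, a * a' = t%:R, 0 < a & a < a'].
Proof.
rewrite -(ler_nat R); set u : R := t%:R => u1.
pose D := (u ^+ 2 + u + 1) ^+ 2 - 4 * u.
have D0 : 0 < D.
  have -> : D = (u ^+ 2) ^+ 2 + 2 * u * u ^+ 2 + 3 * u ^+ 2 - 2 * u + 1.
    by rewrite /D; ring.
  nra.
have sD : Num.sqrt D ^+ 2 = D by rewrite sqr_sqrtr// ltW.
have sD0 : 0 < Num.sqrt D by rewrite sqrtr_gt0.
exists ((u ^+ 2 + u + 1 - Num.sqrt D) / 2), ((u ^+ 2 + u + 1 + Num.sqrt D) / 2).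
have hm : (u ^+ 2 + u + 1 - Num.sqrt D) / 2 * ((u ^+ 2 + u + 1 + Num.sqrt D) / 2) = u.
  transitivity (((u ^+ 2 + u + 1) ^+ 2 - Num.sqrt D ^+ 2) / 4); first by field.
  by rewrite sD /D; field.
split=> //; [by field| |by lra].
(* The smaller root is positive because the larger one and the product are. *)
rewrite -(pmulr_lgt0 _ (_ : 0 < (u ^+ 2 + u + 1 + Num.sqrt D) / 2)).
  by rewrite hm; lra.
by nra.
Qed.

Lemma companion_separable m : exists N : nat, forall t : nat, (N <= t)%N ->
  separable_poly (cpoly R (companion t m.+1)).
Proof.
pose a : {poly C} := cpoly R (pencil m.+1).1.
pose b : {poly C} := cpoly R (pencil m.+1).2.
have w0 : a * b^`() - a^`() * b != 0.
  (* At [0] the Wronskian equals [A(0) B'(0) = (-1)^(2m+1)], as [B(0) = 0]. *)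
  apply/negP => /eqP/(congr1 (horner^~ 0)).
  rewrite /= hornerD hornerN !hornerM !ev0 (pencil_coef0 _).1 (pencil_coef0 _).2.
  rewrite deriv_map ev0 coef_deriv pencil_coef1 horner0 mulr0 subr0.
  rewrite mulr1n -rmorphM -exprD addSn => /eqP.
  by rewrite rmorphXn rmorphN1 signr_eq0.
have [M Mr hM] := separable_pencil w0 (@pencil_no_common_root _ m.+1).
exists (Num.bound (complex.Re M)) => t tM.
rewrite /companion /cpoly rmorphD /= -mul_polyC rmorphM /= map_polyC mul_polyC /=.
apply: hM; rewrite -(RRe_real Mr) -pmulrn normr_nat -[t%:R](rmorph_nat (real_complex R)).
rewrite ltcR (lt_le_trans (unstable.ltr_bound _))// ler_nat//.
Qed.

Lemma ev_companion_roots (t : nat) m (a a' : R) :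
    a + a' = t%:R ^+ 2 + t%:R + 1 -> a * a' = t%:R ->
  [/\ (rpoly (quadratic t)).[a] = 0,
      (rpoly (companion t m)).[a] = (a ^+ 2 + (t%:R + 1) * a - 1) ^+ m
    & (a ^+ 2 + (t%:R + 1) * a - 1) * (a' ^+ 2 + (t%:R + 1) * a' - 1) = -1].
Proof.
move=> hs hp; have q0 : (rpoly (quadratic t)).[a] = 0.
  by rewrite ev_quadratic -pmulrn -hs -hp; ring.
split=> //; first by rewrite ev_companion_root.
by apply: (@ev_companion_conj R t); rewrite -pmulrn.
Qed.

(** The factors are separable and pairwise coprime: at a root of the quadratic, [companion] is a
    power of a factor of [-1], and neither polynomial vanishes at [0]. *)
Lemma family_separable (b : bool) m : exists N : nat, forall t : nat, (N <= t)%N ->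
  separable_poly (cpoly R (family b t m.+1)).
Proof.
have [N hN] := companion_separable m.
exists (maxn 1 N) => t; rewrite geq_max => /andP[t1 tN].
have [a [a' [hs hp a0 aa']]] := quadratic_roots t1.
have [_ ca cn] := ev_companion_roots m.+1 hs hp.
(* The same evaluation with the two roots exchanged. *)
have [_ ca' _] := ev_companion_roots m.+1
  (etrans (addrC a' a) hs) (etrans (mulrC a' a) hp).
have qE : cpoly R (quadratic t) = ('X - a%:C%C%:P) * ('X - a'%:C%C%:P).
  have -> : cpoly R (quadratic t) = map_poly (real_complex R) (rpoly (quadratic t)).
    by rewrite -map_poly_comp; apply: eq_map_poly => k /=; rewrite rmorph_int.
  have -> : rpoly (quadratic t) = ('X - a%:P) * ('X - a'%:P).
    rewrite /quadratic -mul_polyC !(rmorphD, rmorphM, rmorphN, map_polyC) /=.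
    rewrite !map_polyX !map_polyC /= -pmulrn.
    have := congr1 polyC hs; have := congr1 polyC hp.
    rewrite !(rmorphD, rmorphM) /= => <- <-.
    by ring.
  by rewrite rmorphM !rmorphB /= !map_polyX !map_polyC.
have qr z : root (cpoly R (quadratic t)) z -> (cpoly R (companion t m.+1)).[z] != 0.
  rewrite qE rootM !root_XsubC => /orP[] /eqP ->; rewrite cpoly_real.
    rewrite ca rmorphXn expf_neq0// fmorph_eq0; apply/eqP => h.
    by move: cn; rewrite h mul0r => /eqP; rewrite eq_sym oppr_eq0 oner_eq0.
  rewrite ca' rmorphXn expf_neq0// fmorph_eq0; apply/eqP => h.
  by move: cn; rewrite h mulr0 => /eqP; rewrite eq_sym oppr_eq0 oner_eq0.
have sQ : separable_poly (cpoly R (quadratic t)).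
  have := separable_prod_XsubC [:: a%:C%C; a'%:C%C].
  rewrite !big_cons big_nil mulr1 -qE => ->; rewrite /= andbT inE.
  by rewrite (inj_eq (@complexI R)) lt_eqF.
have sQC : separable_poly (cpoly R (quadratic t * companion t m.+1)).
  rewrite /cpoly rmorphM separable_mul sQ hN//=.
  exact/Pdiv.ClosedField.coprimepP.
have E0 : (cpoly R (quadratic t * companion t m.+1)).[0] != 0.
  rewrite /cpoly rmorphM hornerM ev_quadratic ev_companion !ev0.
  rewrite (pencil_coef0 _).1 (pencil_coef0 _).2 !mulr0 expr0n /= subr0 add0r addr0.
  by rewrite mulf_neq0// ?rmorphXn ?rmorphN1 ?signr_eq0// -pmulrn pnatr_eq0 -lt0n.
rewrite /family; case: b => /=; last by rewrite mul1r.
rewrite /cpoly rmorphM separable_mul sQC /= map_polyX.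
have := separable_prod_XsubC [:: 0 : C].
rewrite big_cons big_nil mulr1 subr0 => -> /=.
apply/Pdiv.ClosedField.coprimepP => z.
by rewrite /root hornerX => /eqP ->.
Qed.

(** * Two close roots *)

(** Write [B' = q X + c] with [c = B'(0)] of modulus 1. In [A' + t B'] the term [t c] dominates:
    [A'(x)] is bounded, and so is [t q(x) x] because [x <= 2 / t]. *)
Lemma companion_deriv_ge m : exists N : nat, forall (t : nat) (x : R),
    (N <= t)%N -> 0 <= x -> x * t%:R <= 2 ->
  t%:R / 2 <= `|((rpoly (companion t m.+1))^`()).[x]|.
Proof.
pose A := rpoly (pencil m.+1).1; pose B := rpoly (pencil m.+1).2.
have [CA hA] := poly_disk_bound A^`() 1.
have [q [c qE]] : exists q c, B^`() = q * 'X + c%:P.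
  by elim/poly_ind: (B^`()) => [|q c _]; [exists 0, 0; rewrite mul0r addr0|exists q, c].
have [CB hB] := poly_disk_bound q 1.
have c1 : `|c| = 1.
  have : B^`().[0] = c by rewrite qE !hornerE.
  rewrite /B deriv_map ev0 coef_deriv pencil_coef1 mulr1n rmorphXn rmorphN1 => <-.
  by rewrite normrX normrN1 expr1n.
(* The error is at most [2 CB + CA], hence at most [t / 2]; [t >= 2] puts [x] in the unit disk. *)
exists (maxn 2 (Num.bound (4 * CB + 2 * CA))) => t x; rewrite geq_max => /andP[t2 tM] x0 xt.
have {}tM : 4 * CB + 2 * CA <= t%:R.
  by rewrite (le_trans (ltW (unstable.ltr_bound _)))// ler_nat.
have {}t2 : 2 <= t%:R :> R by rewrite ler_nat.
have x1 : `|x| <= 1 by rewrite ger0_norm//; nra.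
have -> : rpoly (companion t m.+1) = A + t%:R *: B.
  by rewrite /companion rmorphD /= map_polyZ /= -pmulrn.
rewrite derivD derivZ qE hornerD hornerZ hornerD hornerM hornerX hornerC.
have {hA} := hA x x1; have {hB} := hB x x1.
set u := t%:R in t2 tM xt *.
set y := q.[x]; set z := A^`().[x] => hy hz.
have : `|u * c| <= `|z + u * (y * x + c)| + `|u * (y * x)| + `|z|.
  have -> : u * c = z + u * (y * x + c) - u * (y * x) - z by ring.
  by rewrite (le_trans (ler_normB _ _))// lerD2r ler_normB.
rewrite !normrM c1 (ger0_norm x0) (@ger0_norm _ u); last by lra.
move=> h.
have : u * (`|y| * x) <= 2 * CB.
  have -> : u * (`|y| * x) = `|y| * (x * u) by ring.
  have := normr_ge0 y; have : 0 <= x * u by nra.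
  by nra.
by move: h; rewrite mulr1; lra.
Qed.

Lemma sep_family_le (b : bool) m : exists (K : R) (N : nat), 0 < K /\
  forall t : nat, (N <= t)%N ->
    0 < sep R (family b t m.+1) <= K / t%:R ^+ (4 * m.+1 + 1).
Proof.
have [N1 h1] := family_separable b m.
have [N2 h2] := companion_deriv_ge m.
(* The degree of [companion] times the constant in [|s(a)|^(m+1) <= (4 / t^4)^(m+1)]. *)
pose k : R := (2 * m.+1)%:R * 4 ^+ m.+1.
have k0 : 0 <= k by rewrite mulr_ge0// exprn_ge0.
exists (2 * k + 1), (maxn 1 (maxn N1 N2)); split; first by lra.
move=> t; rewrite !geq_max => /and3P[t1 tN1 tN2].
have [a [a' [hs hp a0 aa']]] := quadratic_roots t1.
have [qa ca cn] := ev_companion_roots m.+1 hs hp.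
have u1 : 1 <= t%:R :> R by rewrite ler1n.
have u0 : 0 < t%:R :> R by rewrite ltr0n.
(* The larger root is at least half the sum; the product [t] then gives [a <= 2 / t]. *)
have ha' : t%:R ^+ 2 / 2 <= a' by rewrite expr2; rewrite expr2 in hs; nra.
have at2 : a * t%:R <= 2.
  have : a * (t%:R ^+ 2 / 2) <= t%:R by rewrite -[leRHS]hp ler_wpM2l// ltW.
  have -> : a * (t%:R ^+ 2 / 2) = a * t%:R / 2 * t%:R by field.
  by rewrite -[leRHS]mul1r ler_pM2r//; lra.
have hd := h2 t a tN2 (ltW a0) at2.
set v := a ^+ 2 + _ - 1 in ca cn.
(* Here [v = s(a)] and [w = s(a')] satisfy [|v| w = 1], and [w >= t^4 / 4]. *)
have hv : `|v| <= 4 / t%:R ^+ 4.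
  rewrite ler_pdivlMr ?exprn_gt0//.
  set w := a' ^+ 2 + _ - 1 in cn.
  have hw : t%:R ^+ 4 / 4 <= w.
    have : (t%:R ^+ 2 / 2) ^+ 2 <= a' ^+ 2.
      by rewrite lerXn2r ?nnegrE// ?divr_ge0 ?exprn_ge0// ltW// (lt_trans a0).
    have -> : (t%:R ^+ 2 / 2) ^+ 2 = t%:R ^+ 4 / 4 :> R by field.
    have : 1 <= (t%:R + 1) * a'.
      have a2 : 1 / 2 <= a'.
        by apply: le_trans ha'; rewrite ler_pM2r ?invr_gt0// exprn_ege1.
      rewrite [leLHS](_ : 1 = 2 * (1 / 2)); last by field.
      by rewrite ler_pM//; lra.
    by rewrite /w; lra.
  have : `|v| * w = 1.
    have w0 : 0 <= w by apply: le_trans hw; rewrite divr_ge0// exprn_ge0// ltW.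
    by rewrite -{1}(ger0_norm w0) -normrM cn normrN1.
  have := normr_ge0 v; move: (`|v|) hw => V; set u4 := t%:R ^+ 4; nra.
have sP : (2 < size (family b t m.+1))%N by rewrite size_family; lia.
have [[z1 [z2 [_ _ z12 sE]]] slb] := sep_min sP (h1 t tN1).
apply/andP; split.
  rewrite sE; have : 0 < `|z1 - z2| by rewrite normr_gt0 subr_eq0.
  by rewrite -ltcR; case: (z1 - z2).
(* The derivative bound [t / 2] accounts for the factor 2, and the added 1 makes the hypothesis of
   [exists_near_root] strict. *)
set e := (2 * k + 1) / _.
have e0 : 0 <= e by rewrite divr_ge0 ?exprn_ge0//; lra.
have v0 : v != 0.
  by apply: contra_eq_neq cn => ->; rewrite mul0r eq_sym oppr_eq0 oner_eq0.
have normC (x : R) : `|x%:C%C| = `|x|%:C%C.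
  by rewrite normc_def /= expr0n addr0 sqrtr_sqr.
have [||| z rz hz] := @exists_near_root _ (cpoly R (companion t m.+1)) a%:C%C e%:C%C.
- by rewrite monicE lead_coef_map_inj ?(monicP (companion_monic _ _))//; exact: intr_inj.
- by rewrite ler0c.
- rewrite size_cpoly size_companion /cpoly deriv_map !cpoly_real -deriv_map !normC ca.
  rewrite -[_%:R](rmorph_nat (real_complex R)) -!rmorphM ltcR normrX.
  apply: (@le_lt_trans _ _ (k / t%:R ^+ (4 * m.+1))).
    rewrite /k -mulrA ler_wpM2l// exprM -expr_div_n lerXn2r ?nnegrE//.
  apply: (@lt_le_trans _ _ (e * (t%:R / 2))); last by rewrite ler_wpM2l.
  have -> : e * (t%:R / 2) = (k + 1 / 2) / t%:R ^+ (4 * m.+1).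
    by rewrite /e addn1 exprSr; field; rewrite expf_neq0 gt_eqF.
  by rewrite ltr_pM2r ?invr_gt0 ?exprn_gt0//; lra.
(* The nearby root is not [a] itself, since [s(a)] is nonzero. *)
have az : a%:C%C != z.
  apply: contraTneq rz => <-; rewrite /root cpoly_real ca fmorph_eq0.
  by rewrite expf_neq0.
apply: (@le_trans _ _ (Normc.normc (a%:C%C - z))).
  apply: slb; exists a%:C%C, z; split=> //.
    have ra : root (cpoly R (quadratic t)) a%:C%C by rewrite /root cpoly_real qa.
    by rewrite /family /cpoly !rmorphM !rootM ra !orbT.
  by rewrite /family /cpoly !rmorphM !rootM rz !orbT.
by rewrite -lecR; apply: ltW; move: hz; case: (a%:C%C - z).
Qed.

(** * Passage to the limit superior *)

Lemma exists_nat_ln_ge (x : R) (N : nat) :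
  exists t : nat, (N < t)%N /\ x <= ln (t%:R : R).
Proof.
have u0 : 0 <= expR x + N%:R by rewrite addr_ge0 ?expR_ge0.
have hb := archi_boundP u0; set t := Num.bound _ in hb; exists t.
have xt : expR x < t%:R by rewrite (le_lt_trans _ hb)// lerDl.
split; first by rewrite -(ltr_nat R) (le_lt_trans _ hb)// lerDr expR_ge0.
by rewrite -[leLHS]expRK ler_ln ?posrE ?expR_gt0 ?ltW// (lt_trans (expR_gt0 x)).
Qed.

(** With [sep <= K / t^(3e)] and height at most [(D + 1) t^3], the exponent is at least
    [(3e ln t - ln K) / (3 ln t + ln (D + 1))], which tends to [e]. *)
Lemma estar_ge (b : bool) m :
  (((4 * m.+1 + 1)%:R / 3 : R)%:E <= estar R (2 * m.+1 + 2 + b))%E.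
Proof.
set e := _ / 3; have e0 : 0 < e by rewrite divr_gt0// ltr0n addn1.
have e3 : (4 * m.+1 + 1)%:R = 3 * e by rewrite /e mulrC divfK.
apply: le_ereal_inf_tmp => _ [N _ <-]; apply/lee_subgt0Pr => eps eps0.
have [K [N1 [K0 hK]]] := sep_family_le b m.
have [N2 hN2] := family_separable b m.
have [D hD] := height_family_le b m.+1.
(* Capping at [e] keeps [e - eps'] nonnegative, so the upper bound on [ln H] may be multiplied by
   it. *)
pose eps' := Num.min eps e.
have eps'0 : 0 < eps' by rewrite lt_min eps0 e0.
have eps'e : eps' <= e by rewrite ge_min lexx orbT.
have lD0 : 0 <= ln (D.+1%:R : R) by rewrite ln_ge0// ler1n.
(* This threshold makes [3 eps' ln t] absorb [ln K + e ln (D + 1)]. *)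
have [t [+ tx]] := exists_nat_ln_ge ((ln K + e * ln (D.+1%:R : R)) / (3 * eps'))
  (maxn 1 (maxn N (maxn N1 N2))).
rewrite !gtn_max => /and4P[t1 tN tN1 tN2].
have /andP[s0 sK] := hK t (ltnW tN1).
have t0 : 0 < t%:R :> R by rewrite ltr0n (ltn_trans _ t1).
have Ht : (t <= height (family b t m.+1))%N := height_family_ge b t m.+1.
have H1 : (1 < height (family b t m.+1))%N := leq_trans t1 Ht.
apply: (@le_trans _ _ (sepexp R (family b t m.+1))%:E); last first.
  apply: ereal_sup_ubound; exists (family b t m.+1) => //; split=> /=.
    by split; [exact: family_monic|exact: size_family|exact: hN2 (ltnW tN2)].
  exact: leq_trans (ltnW tN) Ht.
rewrite -EFinB lee_fin; apply: (@le_trans _ _ (e - eps')).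
  by rewrite lerD2l lerN2 ge_min lexx.
have H0 : 0 < (height (family b t m.+1))%:R :> R by rewrite ltr0n ltnW.
rewrite /sepexp ler_pdivlMr ?ln_gt0 ?ltr1n//.
have lnH : ln ((height (family b t m.+1))%:R : R) <= ln (D.+1%:R : R) + 3 * ln (t%:R : R).
  have -> : 3 * ln (t%:R : R) = ln (t%:R ^+ 3 : R) by rewrite lnXn// mulr_natl.
  rewrite -lnM ?posrE ?exprn_gt0// ler_ln ?posrE ?mulr_gt0 ?exprn_gt0//.
  rewrite -natrX -natrM ler_nat (leq_trans (hD t (ltnW t1)))//.
  by rewrite leq_mul2r leqnSn orbT.
have lnS : ln (sep R (family b t m.+1)) <= ln K - 3 * e * ln (t%:R : R).
  have -> : 3 * e * ln (t%:R : R) = ln (t%:R ^+ (4 * m.+1 + 1) : R).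
    by rewrite lnXn// -e3 mulr_natl.
  by rewrite -ln_div ?posrE ?exprn_gt0// ler_ln ?posrE ?divr_gt0 ?exprn_gt0.
move: tx; rewrite ler_pdivrMr ?mulr_gt0// => tx.
apply: (@le_trans _ _ ((e - eps') * (ln (D.+1%:R : R) + 3 * ln (t%:R : R)))).
  by rewrite ler_wpM2l// subr_ge0.
have : 0 <= eps' * ln (D.+1%:R : R) by rewrite mulr_ge0// ltW.
by lra.
Qed.

End Asymptotics.

Theorem theorem2 (R : realType) :
  (forall d : nat, (6 <= d)%N -> ~~ odd d ->
     (((2 * d%:R - 3) / 3 : R)%:E <= estar R d)%E) /\
  (forall d : nat, (7 <= d)%N -> odd d ->
     (((2 * d%:R - 5) / 3 : R)%:E <= estar R d)%E).
Proof.
split=> d d_ge d_odd.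
  (* Here [4 (m + 1) + 1 = 2d - 3]. *)
  have [m ->] : exists m, d = (2 * m.+1 + 2 + false)%N by exists (d./2 - 2)%N; lia.
  have := estar_ge R false m; congr (_ <= _)%E; congr (_%:E); congr (_ / _).
  by rewrite !natrD !natrM -!natr1 /=; ring.
(* The factor [X] uses up one degree: [4 (m + 1) + 1 = 2 (d - 1) - 3]. *)
have [m ->] : exists m, d = (2 * m.+1 + 2 + true)%N by exists (d./2 - 2)%N; lia.
have := estar_ge R true m; congr (_ <= _)%E; congr (_%:E); congr (_ / _).
by rewrite !natrD !natrM -!natr1 /=; ring.
Qed.
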